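(* Let $f=\sum_{|\alpha|\ge1}a_\alpha X_\alpha$ be a positive regular free holomorphic function and let $\mathcal P$ be a set of noncommutative polynomials. Every $n$-tuple $T=(T_1,\dots,T_n)\in\mathcal V^1_{f,\mathcal P}(\mathcal H)$ has a triangulation of type $$\begin{pmatrix}C_{\cdot0}&0\\ *&C_{\cdot1}\end{pmatrix}.$$ Moreover, this triangulation is uniquely determined (i.e., the decomposition $\mathcal H=\mathcal H_0\oplus\mathcal H_1$ inducing it is unique).
   Context: Let $n\in\mathbb N=\{1,2,\dots\}$. $\mathbb F_n^+$ is the unital free semigroup on generators $g_1,\dots,g_n$ with identity $g_0$; $|\alpha|$ is the word length ($|g_0|=0$). For $X=(X_1,\dots,X_n)\in B(\mathcal H)^n$ ($\mathcal H$ a complex Hilbert space) put $X_\alpha=X_{i_1}\cdots X_{i_k}$ if $\alpha=g_{i_1}\cdots g_{i_k}$ and $X_{g_0}=I$. A positive regular free holomorphic function is a formal series $f=\sum_{\alpha\in\mathbb F_n^+}a_\alpha X_\alpha$ in noncommuting variables with $\limsup_{k\to\infty}(\sum_{|\alpha|=k}|a_\alpha|^2)^{1/2k}<\infty$, $a_\alpha\ge 0$ for all $\alpha$, $a_{g_0}=0$, and $a_{g_i}>0$ for $i=1,\dots,n$. Whenever $\sum_{|\alpha|\ge1}a_\alpha X_\alpha X_\alpha^*$ converges in the weak operator topology (WOT), $\Phi_{f,X}(Y)=\sum_{|\alpha|\ge1}a_\alpha X_\alpha YX_\alpha^*$ for $Y\in B(\mathcal H)$ (WOT convergence). $\mathcal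 V^1_{f,\mathcal P}(\mathcal H)$ is the set of all $X\in B(\mathcal H)^n$ with $\sum_{|\alpha|\ge1}a_\alpha X_\alpha X_\alpha^*\le I$ and $p(X_1,\dots,X_n)=0$ for all $p\in\mathcal P$. $T\in\mathcal V^1_{f,\mathcal P}(\mathcal H)$ is of class $C_{\cdot0}$ if $\lim_{k\to\infty}\langle\Phi_{f,T}^k(I)h,h\rangle=0$ for every $h\in\mathcal H$, and of class $C_{\cdot1}$ if $\lim_{k\to\infty}\langle\Phi_{f,T}^k(I)h,h\rangle\ne0$ for every $h\in\mathcal H$, $h\ne0$. $T$ has a triangulation of type $C_{\cdot0}-C_{\cdot1}$, i.e. of type $\begin{pmatrix}C_{\cdot0}&0\\ *&C_{\cdot1}\end{pmatrix}$, if there is an orthogonal decomposition $\mathcal H=\mathcal H_0\oplus\mathcal H_1$ (either summand may be $\{0\}$) with respect to which $T_i=\begin{pmatrix}C_i&0\\ *&D_i\end{pmatrix}$, $i=1,\dots,n$, where (i) $T_i^*\mathcal H_0\subseteq\mathcal H_0$ for all $i$; (ii) $(C_1,\dots,C_n)\in\mathcal V^1_{f,\mathcal P}(\mathcal H_0)$ is of class $C_{\cdot0}$; (iii) $(D_1,\dots,D_n)\in\mathcal V^1_{f,\mathcal P}(\mathcal H_1)$ is of class $C_{\cdot1}$. The entry $*$ is not specified. *)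

(* Defs.v *)
From HB Require Import structures.
From mathcomp Require Import all_boot all_order all_algebra finmap complex.
From mathcomp Require Import all_classical all_reals all_analysis.

Set Implicit Arguments.
Unset Strict Implicit.
Unset Printing Implicit Defensive.

Import Order.TTheory GRing.Theory Num.Theory.
Import numFieldNormedType.Exports.

Local Open Scope classical_set_scope.
Local Open Scope ring_scope.
Local Open Scope complex_scope.

(* [{dot H for Num.conj}] is linear in its first variable, conjugate-linear in
   the second one. *)
HB.mixin Record CompleteNormedModule_isHilbert (R : realType) H
    & CompleteNormedModule R[i] H := {
  inner : {dot H for Num.conj} ;
  innerxx : forall x : H, inner x x = `|x| ^+ 2
}.

#[short(type="hilbertType")]
HB.structure Definition Hilbert (R : realType) :=
  {H of CompleteNormedModule_isHilbert R H & CompleteNormedModule R[i] H}.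

#[short(type="bopType")]
HB.structure Definition Bop (R : realType) (H : hilbertType R) :=
  {f of @GRing.Linear R[i] H H *:%R f & @isContinuous H H f}.

HB.instance Definition _ (R : realType) (H : hilbertType R) :=
  gen_eqMixin (bopType H).
HB.instance Definition _ (R : realType) (H : hilbertType R) :=
  gen_choiceMixin (bopType H).

Notation "''B' ( H )" := (bopType H) (at level 8, format "''B' ( H )").

Section Operators.
Context {R : realType} {H : hilbertType R}.

HB.instance Definition _ := GRing.Linear.on (@idfun H).
HB.instance Definition _ (S T : 'B(H)) := GRing.Linear.on (S \o T).

Definition bop_id : 'B(H) := Bop.clone R H (@idfun H) _.
Definition bop_comp (S T : 'B(H)) : 'B(H) := Bop.clone R H (S \o T) _.

(* By the Riesz representation theorem the set below is a singleton, so the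
   default value is never returned. *)
Definition adjoint (T : 'B(H)) : 'B(H) :=
  xget bop_id [set S : 'B(H) | forall x y, inner (T x) y = inner x (S y)].

Definition wot_cvg (S : nat -> H -> H) (Z : H -> H) : Prop :=
  forall h k, (inner (S m h) k : R[i]^o) @[m --> \oo] --> (inner (Z h) k : R[i]^o).

Definition ople (S T : H -> H) : Prop := forall h, inner (S h) h <= inner (T h) h.

End Operators.

Record closedSubspace (R : realType) (H : hilbertType R) := ClosedSubspace {
  csub :> submodClosed H ;
  csub_closed : closed [set x : H | x \in csub]
}.

Definition csub_type (R : realType) (H : hilbertType R) (M : closedSubspace H) :=
  {x : H | x \in M}.
Coercion csub_type : closedSubspace >-> Sortclass.

Section SubHilbert.
Context {R : realType} {H : hilbertType R} (M : closedSubspace H).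

HB.instance Definition _ := SubChoice.on (csub_type M).
HB.instance Definition _ := [SubChoice_isSubLmodule of csub_type M by <:].

Let subnorm (x : csub_type M) : R[i] := `|val x|.

Let subnormD (x y : csub_type M) : subnorm (x + y) <= subnorm x + subnorm y.
Proof. by rewrite /subnorm raddfD/= ler_normD. Qed.

Let subnormZ (a : R[i]) (x : csub_type M) : subnorm (a *: x) = `|a| * subnorm x.
Proof. by rewrite /subnorm linearZ/= normrZ. Qed.

Let subnorm0_eq0 (x : csub_type M) : subnorm x = 0 -> x = 0.
Proof. by move=> /normr0_eq0 x0; apply: val_inj; rewrite x0 raddf0. Qed.

HB.instance Definition _ :=
  @Lmodule_isNormed.Build R[i] (csub_type M) subnorm subnormD subnormZ subnorm0_eq0.

Lemma csub_normE (x : csub_type M) : `|x| = `|val x|.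
Proof. by []. Qed.

Let sub_complete (F : set_system (csub_type M)) :
  ProperFilter F -> cauchy F -> cvg F.
Proof.
move=> FF /cauchyP Fc.
have Gc : cauchy ((val : csub_type M -> H) @ F).
  apply: cauchy_exP => e e0; have [x Fx] := Fc e e0.
  exists (val x); move: Fx; rewrite -!ball_normE /=.
  by apply: filterS => y; rewrite /ball_ /= csub_normE raddfB.
have [l Gl] : exists l : H, (val : csub_type M -> H) @ F --> l.
  by apply/cvg_ex; exact: cauchy_cvg.
have Ml : l \in M.
  apply: (closed_cvg (fun x : H => x \in M) (@csub_closed _ _ M) _ _ Gl).
  by apply: nearW => x; exact: valP.
apply/cvg_ex; exists (Sub l Ml : csub_type M).
apply/cvgrPdist_lt => e e0; move/cvgrPdist_lt : Gl => /(_ e e0).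
by apply: filterS => x; rewrite csub_normE raddfB.
Qed.

HB.instance Definition _ := Uniform_isComplete.Build (csub_type M) sub_complete.

Definition csub_inner (x y : csub_type M) : R[i] := inner (val x) (val y).

Let csub_inner_bilinear : bilinear_for *%R (Num.conj \; *%R) csub_inner.
Proof.
by split=> [y|x] a u v; rewrite /csub_inner linearP/= ?linearPl ?linearPr.
Qed.

HB.instance Definition _ := @bilinear_isBilinear.Build R[i] (csub_type M)
  (csub_type M) R[i] *%R (Num.conj \; *%R) csub_inner csub_inner_bilinear.

Let csub_inner_hermitian (x y : csub_type M) :
  csub_inner x y = (-1) ^+ false * Num.conj (csub_inner y x).
Proof. exact: hermitian_subproof. Qed.

HB.instance Definition _ := @isHermitianSesquilinear.Build R[i] (csub_type M)
  false Num.conj csub_inner csub_inner_hermitian.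

Let csub_inner_gt0 (x : csub_type M) : x != 0 -> 0 < csub_inner x x.
Proof.
by move=> x0; apply: neq0_dnorm_gt0; apply: contra_neq x0 => x0; exact: val_inj.
Qed.

HB.instance Definition _ := @isDotProduct.Build R[i] (csub_type M)
  csub_inner csub_inner_gt0.

Let csub_innerxx (x : csub_type M) : csub_inner x x = `|x| ^+ 2.
Proof. exact: innerxx. Qed.

HB.instance Definition _ := @CompleteNormedModule_isHilbert.Build R (csub_type M)
  csub_inner csub_innerxx.

End SubHilbert.

(* The word g_{i_1} ... g_{i_k} is the sequence [:: i_1; ...; i_k]; words of
   length k are the k-tuples.  [powR] below at k = 0 plays no role. *)
Record posRegular (R : realType) (n : nat) := PosRegular {
  coef :> seq 'I_n -> R ;
  coef_limsup :
    (limn_esup (fun k : nat =>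
       ((\sum_(w : k.-tuple 'I_n) `|coef w| ^+ 2) `^ (2 * k%:R)^-1)%:E) < +oo)%E ;
  coef_ge0 : forall w, 0 <= coef w ;
  coef_nil : coef [::] = 0 ;
  coef_gen : forall i, 0 < coef [:: i]
}.

(* A noncommutative polynomial is its finitely supported family of coefficients. *)
Definition ncpoly (R : realType) (n : nat) :=
  {fsfun seq 'I_n -> R[i] with 0}.

Section Varieties.
Context {R : realType} {n : nat} {H : hilbertType R}.
Implicit Types (f : posRegular R n) (P : set (ncpoly R n)) (X : 'I_n -> 'B(H)).

Definition opword X (w : seq 'I_n) : 'B(H) :=
  foldr (fun i S => bop_comp (X i) S) bop_id w.

Definition ncpoly_eval (p : ncpoly R n) X (h : H) : H :=
  \sum_(w <- finsupp p) p w *: opword X w h.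

(* Series over words are summed by increasing word length. *)
Definition Phi_partial f X (Y : 'B(H)) (m : nat) (h : H) : H :=
  \sum_(1 <= k < m.+1) \sum_(w : k.-tuple 'I_n)
    (f w)%:C *: opword X w (Y (adjoint (opword X w) h)).

(* The WOT limit is unique when it exists; the default value is only returned
   when the series diverges, which does not happen for X in [variety f P]. *)
Definition Phi f X (Y : 'B(H)) : 'B(H) :=
  xget bop_id [set Z : 'B(H) | wot_cvg (Phi_partial f X Y) Z].

(* The first conjunct reads: the series of the f w X_w X_w^* converges in the
   WOT and its sum is at most the identity. *)
Definition variety f P X : Prop :=
  (exists2 Z : 'B(H), wot_cvg (Phi_partial f X bop_id) Z & ople Z bop_id) /\
  (forall p, P p -> forall h, ncpoly_eval p X h = 0).

Definition Phi_seq f X (h : H) (k : nat) : R[i]^o :=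
  inner (iter k (Phi f X) bop_id h) h.

Definition class_C0 f X : Prop :=
  forall h : H, Phi_seq f X h k @[k --> \oo] --> (0 : R[i]^o).

Definition class_C1 f X : Prop :=
  forall h : H, h != 0 ->
    exists2 l : R[i]^o, Phi_seq f X h k @[k --> \oo] --> l & l != 0.

End Varieties.

Section Triangulation.
Context {R : realType} {n : nat} {H : hilbertType R}.

Definition orthogonal_decomposition (H0 H1 : closedSubspace H) : Prop :=
  (forall x y : H, x \in H0 -> y \in H1 -> inner x y = 0) /\
  (forall h : H, exists x y : H, [/\ x \in H0, y \in H1 & h = x + y]).

(* With respect to H0 (+) H1, the first column of the block matrix of S is
   (C, * ) and the second one is (0, D). *)
Definition lower_triangular (H0 H1 : closedSubspace H) (S : 'B(H))
    (C : 'B(H0)) (D : 'B(H1)) : Prop :=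
  (forall x : H0, S (val x) - val (C x) \in H1) /\
  (forall y : H1, S (val y) = val (D y)).

Definition triangulation_C0_C1 (f : posRegular R n) (P : set (ncpoly R n))
    (T : 'I_n -> 'B(H)) (H0 H1 : closedSubspace H) : Prop :=
  orthogonal_decomposition H0 H1 /\
  exists (C : 'I_n -> 'B(H0)) (D : 'I_n -> 'B(H1)),
    [/\ forall i, lower_triangular (T i) (C i) (D i),
        forall i (x : H), x \in H0 -> adjoint (T i) x \in H0,
        variety f P C /\ class_C0 f C
      & variety f P D /\ class_C1 f D].

End Triangulation.

(* Main.v *)
Require Import Defs.
From HB Require Import structures.
From mathcomp Require Import all_boot all_order all_algebra finmap complex.
From mathcomp Require Import all_classical all_reals all_analysis.
From mathcomp Require Import ring lra.

Set Implicit Arguments.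
Unset Strict Implicit.
Unset Printing Implicit Defensive.

Import Order.TTheory GRing.Theory Num.Theory.
Import numFieldNormedType.Exports.

Local Open Scope classical_set_scope.
Local Open Scope ring_scope.
Local Open Scope complex_scope.

(** Write Q_k for the k-th iterate of Phi_(f,T) on the identity.  Since Phi is
    positive and Phi(I) <= I, the Q_k are positive and decrease; let q(h) be
    the limit of <Q_k h, h>.  The null space H0 of the form q is a closed
    subspace, and it is invariant under every T_i^* because
    a_i <Q_k T_i^* h, T_i^* h> <= <Q_(k+1) h, h> with a_i > 0.  Put H1 for the
    orthogonal complement of H0, C for the compression of T to H0 and D for the
    restriction of T to H1.

    As C_w^* is the restriction of T_w^*, the iterates of Phi_(f,C) have the
    quadratic forms of the Q_k restricted to H0 ([coinvariant_qpow]), which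
    tend to 0: C is of class C.0.

    For D, let E be the projection onto H1 and d_k the quadratic form of the
    k-th iterate of Phi_(f,D).  From D_w^* E = E T_w^* one gets, for h in H,
    q(h) <= d_k(E h) <= <Q_k h, h>.  The right inequality
    ([invariant_qpow_le]) is an induction on k.  The left one
    ([qpow_lim_le]) also is: at k = 0 it says q(h) <= |E h|^2, which holds
    since q does not see the component in its null space H0 ([qlimD_null]),
    and the step uses that q is dominated by the series of the a_w q(T_w^* h),
    because the tails of the series defining Phi(Q_k) are bounded uniformly in
    k by those of Phi(I).  So if d_k(h) tends to 0 for some h in H1, then
    q(h) = 0, hence h lies in H0 and in H1, and h = 0: D is of class C.1.

    For uniqueness, the H0' of any triangulation is the null space of q
    ([triangulation_null]).  It is contained in it because C' is of class C.0;
    conversely, if q(x) = 0, the component v of x in H1' satisfies q(v) = 0,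
    and the right inequality above makes the forms of D' tend to 0 at v, so
    that v = 0.  Then H1' is the orthogonal complement of H0'.

    The argument lives on real quadratic forms.  The operators behind them are
    produced by two facts: the Riesz representation ([riesz]), which gives
    adjoints and orthogonal projections, and the strong convergence of monotone
    sequences of positive contractions ([monotone_cvg]), which gives the sum of
    the series defining Phi(Y). *)
(** * Scalars and inner products *)

Definition sqabs (R : realType) (z : R[i]) : R :=
  complex.Re z ^+ 2 + complex.Im z ^+ 2.

Section Inner.
Context {R : realType} {H : hilbertType R}.
Implicit Types (x y z : H) (a : R[i]).

Lemma innerC x y : inner x y = (inner y x)^*.
Proof. by rewrite (hermC inner) expr0 mul1r. Qed.

Lemma innerDl x y z : inner (x + y) z = inner x z + inner y z.
Proof. exact: linearDl. Qed.
Lemma innerDr x y z : inner x (y + z) = inner x y + inner x z.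
Proof. exact: linearDr. Qed.
Lemma innerBl x y z : inner (x - y) z = inner x z - inner y z.
Proof. exact: linearBl. Qed.
Lemma innerBr x y z : inner x (y - z) = inner x y - inner x z.
Proof. exact: linearBr. Qed.
Lemma innerZl a x y : inner (a *: x) y = a * inner x y.
Proof. exact: linearZl_LR. Qed.
Lemma innerZr a x y : inner x (a *: y) = a^* * inner x y.
Proof. exact: linearZr_LR. Qed.
Lemma inner0l x : inner 0 x = 0.
Proof. exact: linear0l. Qed.
Lemma inner0r x : inner x 0 = 0.
Proof. exact: linear0r. Qed.

Definition sqnorm x : R := complex.Re (inner x x).

Lemma sqnormE x : inner x x = (sqnorm x)%:C.
Proof.
have := exprn_ge0 2 (normr_ge0 x); rewrite -innerxx => /ger0_real/RRe_real.
by rewrite /sqnorm => ->.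
Qed.

Lemma sqnorm_norm x : `|x| ^+ 2 = (sqnorm x)%:C.
Proof. by rewrite -innerxx sqnormE. Qed.

Lemma sqnorm_ge0 x : 0 <= sqnorm x.
Proof. by rewrite -ler0c -sqnorm_norm exprn_ge0. Qed.

Lemma sqnorm_eq0 x : (sqnorm x == 0) = (x == 0).
Proof.
by rewrite -(inj_eq (@complexI R)) -sqnorm_norm expf_eq0 /= normr_eq0.
Qed.

Lemma sqnorm0 : sqnorm 0 = 0.
Proof. by apply/eqP; rewrite sqnorm_eq0. Qed.

Lemma normE x : `|x| = (Num.sqrt (sqnorm x))%:C.
Proof.
apply/eqP; rewrite -(@eqrXn2 _ 2) ?ler0c ?sqrtr_ge0// sqnorm_norm -rmorphXn/=.
by rewrite sqr_sqrtr ?sqnorm_ge0.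
Qed.

Lemma sqnormD x y :
  sqnorm (x + y) = sqnorm x + sqnorm y + 2 * complex.Re (inner x y).
Proof.
rewrite /sqnorm innerDl !innerDr (innerC y x).
case: (inner x y) => a b; case: (inner x x) => c d; case: (inner y y) => e f /=.
ring.
Qed.

Lemma sqnormB x y :
  sqnorm (x - y) = sqnorm x + sqnorm y - 2 * complex.Re (inner x y).
Proof.
rewrite /sqnorm innerBl !innerBr (innerC y x).
case: (inner x y) => a b; case: (inner x x) => c d; case: (inner y y) => e f /=.
ring.
Qed.

Lemma sqnormZ a x : sqnorm (a *: x) = sqabs a * sqnorm x.
Proof.
rewrite /sqabs {1}/sqnorm innerZl innerZr sqnormE; case: a => a b /=; ring.
Qed.

Lemma parallelogram x y :
  sqnorm (x + y) + sqnorm (x - y) = 2 * sqnorm x + 2 * sqnorm y.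
Proof. rewrite sqnormD sqnormB; ring. Qed.

Lemma sqnormD_le x y : sqnorm (x + y) <= 2 * sqnorm x + 2 * sqnorm y.
Proof. by rewrite -parallelogram lerDl sqnorm_ge0. Qed.

(** Cauchy-Schwarz: expand the square of the norm of |y|^2 x - <x, y> y. *)
Lemma inner_CS x y : sqabs (inner x y) <= sqnorm x * sqnorm y.
Proof.
rewrite /sqabs.
have [->|y0] := eqVneq y 0.
  by rewrite inner0r /= expr0n sqnorm0 mulr0 addr0.
have y1 : 0 < sqnorm y by rewrite lt_neqAle eq_sym sqnorm_eq0 y0 sqnorm_ge0.
have := sqnorm_ge0 ((sqnorm y)%:C *: x - inner x y *: y).
rewrite sqnormB !sqnormZ /sqabs innerZl innerZr; case: (inner x y) => a b /=.
rewrite expr0n /= addr0 => h; rewrite -subr_ge0 -(pmulr_rge0 _ y1).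
by move: h; congr (_ <= _); ring.
Qed.

End Inner.

(** * Limits of sequences *)

Lemma seq_cvg_ext (T : topologicalType) (u v : nat -> T) (l : T) :
  u =1 v -> u @ \oo --> l -> v @ \oo --> l.
Proof. by move=> /funext ->. Qed.

(** A complex normed space has its norm in R[i]; this reduces convergence in
    it to convergence in R.  It is applied to the Hilbert space and to R[i]. *)
Lemma cvg_sqnormP (R : realType) (V : normedModType R[i]) (N : V -> R)
    (NE : forall x, `|x| ^+ 2 = (N x)%:C) (u : nat -> V) (l : V) :
  u @ \oo --> l <-> (N (l - u m) @[m --> \oo] --> (0 : R)).
Proof.
have N0 x : 0 <= N x by rewrite -ler0c -NE exprn_ge0.
split=> [/cvgrPdist_lt ul|/cvgrPdist_lt Nu].
  apply/cvgrPdist_lt => e e0.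
  have se : 0 < (Num.sqrt e)%:C by rewrite ltcR sqrtr_gt0.
  move: (ul _ se); apply: filterS => m.
  rewrite -(@ltr_pXn2r _ 2) ?nnegrE ?(ltW se)// NE -rmorphXn/= ltcR sqr_sqrtr
    ?ltW//.
  by rewrite sub0r normrN ger0_norm.
apply/cvgrPdist_lt => e e0.
have /RRe_real eR : e \is Num.real by exact: gtr0_real.
move: e0; rewrite -eR ltcR => e0.
move: (Nu _ (exprn_gt0 2 e0)); apply: filterS => m.
rewrite sub0r normrN ger0_norm// -ltcR -NE rmorphXn/= => h.
by rewrite -(@ltr_pXn2r _ 2) ?nnegrE ?normr_ge0 ?ler0c ?(ltW e0)//; exact: h.
Qed.

Section Limits.
Context {R : realType}.

Lemma sqabsE (z : R[i]^o) : `|z| ^+ 2 = (sqabs z)%:C.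
Proof. by rewrite -[LHS]add_Re2_Im2. Qed.

Lemma ReB (z w : R[i]) : complex.Re (z - w) = complex.Re z - complex.Re w.
Proof. by case: z => ? ?; case: w. Qed.

Lemma complex_cvgP (u : nat -> R[i]) (z : R[i]) :
  ((u m : R[i]^o) @[m --> \oo] --> (z : R[i]^o)) <->
  (sqabs (z - u m) @[m --> \oo] --> (0 : R)).
Proof. exact: (cvg_sqnormP sqabsE). Qed.

Lemma sqr_cvg0 (v : nat -> R) : (v m ^+ 2) @[m --> \oo] --> (0 : R) ->
  v @ \oo --> (0 : R).
Proof.
move=> /cvgrPdist_lt h; apply/cvgrPdist_lt => e e0.
move: (h _ (exprn_gt0 2 e0)); apply: filterS => m.
rewrite !sub0r !normrN normrX => h'.
by rewrite -(@ltr_pXn2r _ 2)// nnegrE ?ltW.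
Qed.

Lemma cvg0_le (v w : nat -> R) : (forall m, 0 <= v m <= w m) ->
  w @ \oo --> (0 : R) -> v @ \oo --> (0 : R).
Proof.
move=> vw w0; apply: (squeeze_cvgr _ (cvg_cst (0 : R)) w0).
by apply: nearW => m; exact: vw.
Qed.

Lemma Re_cvg (u : nat -> R[i]) (z : R[i]) :
  ((u m : R[i]^o) @[m --> \oo] --> (z : R[i]^o)) ->
  complex.Re (u m) @[m --> \oo] --> complex.Re z.
Proof.
move=> /complex_cvgP h; apply/subr_cvg0.
have : (complex.Re (z - u m)) @[m --> \oo] --> (0 : R).
  apply/sqr_cvg0/(cvg0_le _ h) => m.
  by rewrite /sqabs sqr_ge0 lerDl sqr_ge0.
move=> /cvgN; rewrite oppr0; apply: cvg_trans.
apply: near_eq_cvg; apply: nearW => m.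
by rewrite -[LHS]/(- complex.Re (z - u m)) ReB opprB.
Qed.

Lemma real_cvg (u : nat -> R) (l : R) :
  u @ \oo --> l <-> (((u m)%:C : R[i]^o) @[m --> \oo] --> (l%:C : R[i]^o)).
Proof.
split=> [h|/Re_cvg//].
apply/complex_cvgP; apply: (@cvg_trans _ ((l - u m) ^+ 2 @[m --> \oo])).
  apply: near_eq_cvg; apply: nearW => m.
  by rewrite /sqabs /= subrr expr0n addr0.
have {}h : (l - u m) @[m --> \oo] --> (0 : R).
  by rewrite -(subrr l); exact: (cvgB (cvg_cst l) h).
by rewrite -(mulr0 (0 : R)); exact: (cvgM h h).
Qed.

Lemma conj_cvg (u : nat -> R[i]) (z : R[i]) :
  ((u m : R[i]^o) @[m --> \oo] --> (z : R[i]^o)) ->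
  (((u m)^* : R[i]^o) @[m --> \oo] --> (z^* : R[i]^o)).
Proof.
move=> /complex_cvgP h; apply/complex_cvgP; apply: seq_cvg_ext h => m.
by rewrite /sqabs; case: z; case: (u m) => /= a b c d; ring.
Qed.

Context {H : hilbertType R}.

Lemma hilbert_cvgP (u : nat -> H) (l : H) :
  u @ \oo --> l <-> (sqnorm (l - u m) @[m --> \oo] --> (0 : R)).
Proof. exact: (cvg_sqnormP (@sqnorm_norm R H)). Qed.

Lemma inner_cvgl (u : nat -> H) (l y : H) : u @ \oo --> l ->
  (inner (u m) y : R[i]^o) @[m --> \oo] --> (inner l y : R[i]^o).
Proof.
move=> /hilbert_cvgP h; apply/complex_cvgP.
apply: (@cvg0_le _ (fun m => sqnorm (l - u m) * sqnorm y)) => [m|].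
  by rewrite -innerBl addr_ge0 ?sqr_ge0//=; exact: inner_CS.
by rewrite -(mul0r (sqnorm y)); exact: (cvgM h (cvg_cst (sqnorm y))).
Qed.

Lemma sqnorm_cauchy (u : nat -> H) (d : nat -> R) : d @ \oo --> (0 : R) ->
  (forall m p, (m <= p)%N -> sqnorm (u m - u p) <= d m) ->
  exists l : H, u @ \oo --> l.
Proof.
move=> d0 ud; suff uc : cauchy (u @ \oo) by apply/cvg_ex; exact: cauchy_cvg.
apply: cauchy_exP => e e0.
have /RRe_real eR : e \is Num.real by exact: gtr0_real.
move: e0; rewrite -eR ltcR => e0.
move/cvgrPdist_lt : d0 => /(_ _ (exprn_gt0 2 e0)) [N _ dN].
exists (u N); exists N => //= m Nm.
rewrite -ball_normE /ball_ /= -(@ltr_pXn2r _ 2) ?nnegrE ?ler0c// ?(ltW e0)//.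
rewrite sqnorm_norm -rmorphXn ltcR (le_lt_trans (ud _ _ Nm))//.
have := dN N (leqnn N); rewrite /= sub0r normrN.
by apply: le_lt_trans (ler_norm _).
Qed.

End Limits.

(** * Riesz representation, adjoints and closed subspaces *)

Section Riesz.
Context {R : realType} {H : hilbertType R}.

(** The adjoints, compressions and limits of operators constructed below are
    bare functions at first; this makes them elements of 'B(H). *)
Lemma exists_bop (g : H -> H) (M : R) : 0 <= M -> linear g ->
  (forall x, sqnorm (g x) <= M * sqnorm x) ->
  exists S : 'B(H), forall x, S x = g x.
Proof.
move=> M0 gl gM.
pose L : {linear H -> H} := HB.pack g (GRing.isLinear.Build _ _ _ _ g gl).
have gc : continuous g.
  have : bounded_near L (nbhs (0 : H)).
    apply/linear_boundedP; exists (Num.sqrt M)%:C; split.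
      by rewrite ger0_real// ler0c sqrtr_ge0.
    move=> r Mr x; apply: le_trans (ler_wpM2r (normr_ge0 x) (ltW Mr)).
    by rewrite !normE -rmorphM lecR -sqrtrM// ler_wsqrtr// gM.
  by move=> /bounded_linear_continuous.
pose S : 'B(H) := HB.pack g (GRing.isLinear.Build _ _ _ _ g gl)
  (isContinuous.Build _ _ g gc).
by exists S.
Qed.

Lemma bop_bounded (S : 'B(H)) :
  exists2 M : R, 0 <= M & forall x, sqnorm (S x) <= M * sqnorm x.
Proof.
have Sc : continuous S by exact: cts_fun.
have /linear_boundedP := (linear_bounded_continuous S).2 Sc.
move=> /pinfty_ex_gt0[e e0 Se].
have /RRe_real eR : e \is Num.real by exact: gtr0_real.
exists (complex.Re e ^+ 2); first exact: sqr_ge0.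
move=> x; rewrite -lecR rmorphM rmorphXn /= eR -!sqnorm_norm -exprMn.
by apply: lerXn2r; rewrite ?nnegrE ?mulr_ge0 ?(ltW e0)//; exact: Se.
Qed.

(** The representing vector minimises J(x) = |x|^2 - 2 Re phi(x).  J is bounded
    below because phi is bounded, the parallelogram identity makes minimising
    sequences Cauchy, and at the limit l the first variation of J vanishes in
    every direction z, that is, Re <z, l> = Re phi(z).  Taking the directions x
    and i x separates the real and imaginary parts. *)
Lemma riesz (phi : H -> R[i]) (M : R) :
  (forall a x y, phi (a *: x + y) = a * phi x + phi y) -> 0 <= M ->
  (forall x, sqabs (phi x) <= M * sqnorm x) ->
  exists y, forall x, phi x = inner x y.
Proof.
move=> phil M0 phiM.
have phiD x y : phi (x + y) = phi x + phi y.
  by have := phil 1 x y; rewrite scale1r mul1r.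
have phi0 : phi 0 = 0.
  have /(congr1 (fun t => t - phi 0)) := phiD 0 0.
  by rewrite addr0 subrr addrK => <-.
have phiZ a x : phi (a *: x) = a * phi x.
  by have := phil a x 0; rewrite addr0 phi0 addr0.
pose J x := sqnorm x - 2 * complex.Re (phi x).
have JM x : - M <= J x.
  have := phiM x; have := sqnorm_ge0 x; rewrite /sqabs /J.
  set s := sqnorm x; set t := complex.Re _; set u := complex.Im _ => s0 tsM.
  suff : 2 * t <= M + s by lra.
  have [t0|t0] := lerP t 0; first by lra.
  rewrite -(@ler_pXn2r _ 2) ?nnegrE//; [|by lra|by lra].
  have := sqr_ge0 (M - s); have := sqr_ge0 u; lra.
pose d := inf (range J).
have infJ : has_inf (range J).
  apply: conj; first by exists (J 0); exists 0.
  by exists (- M) => _ [x _ <-].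
have dJ x : d <= J x by apply: ge_inf; [exact: infJ.2|exists x].
have /choice[u uJ] (m : nat) : exists x, J x < d + harmonic m.
  have [_ [x _ <-]] := inf_adherent (harmonic_gt0 m) infJ.
  by exists x.
have hc := @cvg_harmonic R.
have [l ul] : exists l : H, u @ \oo --> l.
  apply: (@sqnorm_cauchy _ _ _ (fun m => 4 * harmonic m)).
    by rewrite -(mulr0 4); exact: (cvgM (cvg_cst _) hc).
  (* J (u m) + J (u p) = 2 J z + |u m - u p|^2 / 2 at the midpoint z. *)
  move=> m p mp; pose z := (2^-1)%:C *: (u m + u p).
  have := dJ z; have := uJ m; have := uJ p.
  have : harmonic p <= harmonic m :> R.
    by rewrite /harmonic lef_pV2 ?posrE// ler_nat.
  have := parallelogram (u m) (u p).
  rewrite /J /z sqnormZ /sqabs phiZ phiD.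
  case: (phi (u m)) => a b; case: (phi (u p)) => a' b'.
  rewrite /=; move: (m.+1%:R^-1) (p.+1%:R^-1) => hm hp; lra.
have key z : complex.Re (phi z) = complex.Re (inner z l).
  pose c := complex.Re (inner l z) - complex.Re (phi z).
  have sc s : 0 <= 2 * s * c + s ^+ 2 * sqnorm z.
    pose v m := 2 * s * (complex.Re (inner (u m) z) - complex.Re (phi z)) +
      s ^+ 2 * sqnorm z + harmonic m.
    have vl : v @ \oo --> 2 * s * c + s ^+ 2 * sqnorm z + 0.
      apply: cvgD hc; apply: cvgD (cvg_cst _); apply: cvgM (cvg_cst _) _.
      by apply: cvgB (cvg_cst _); apply: Re_cvg; exact: inner_cvgl.
    rewrite -[leRHS]addr0; apply: (cvgr_to_ge vl); apply: nearW => m.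
    have := dJ (u m + s%:C *: z); have := uJ m; rewrite /J /v phiD phiZ.
    rewrite sqnormD sqnormZ /sqabs innerZr.
    case: (phi z) => a b; case: (phi (u m)) => a' b';
      case: (inner (u m) z) => e f.
    rewrite /=; move: (m.+1%:R^-1) => hm; lra.
  have N0 := sqnorm_ge0 z.
  suff c0 : c = 0.
    by rewrite innerC; apply/esym/subr0_eq; rewrite -c0 /c; case: (inner l z).
  have N1 : 0 < sqnorm z + 1 by lra.
  (* Any small multiple of - c makes the form negative unless c = 0; this one
     avoids a division by zero when z = 0. *)
  have := sc (- c / (sqnorm z + 1)).
  have -> : 2 * (- c / (sqnorm z + 1)) * c +
      (- c / (sqnorm z + 1)) ^+ 2 * sqnorm z =
      - (c ^+ 2 * ((sqnorm z + 2) / (sqnorm z + 1) ^+ 2)).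
    by field; rewrite gt_eqF.
  rewrite oppr_ge0 pmulr_lle0; last by rewrite divr_gt0 ?exprn_gt0//; lra.
  by rewrite le_eqVlt ltNge sqr_ge0 orbF sqrf_eq0 => /eqP.
exists l => x; have := key ('i *: x); have := key x.
rewrite phiZ innerZl; case: (phi x) => a b; case: (inner x l) => a' b' /=.
by move=> -> h; apply/eqP; rewrite eq_complex /= eqxx /=; apply/eqP; lra.
Qed.

Lemma inner_extr (y z : H) : (forall x, inner x y = inner x z) -> y = z.
Proof.
move=> h; apply/eqP; rewrite -subr_eq0 -sqnorm_eq0 /sqnorm innerBr h subrr.
exact/eqP.
Qed.

Lemma adjointP (T : 'B(H)) x y : inner (T x) y = inner x (adjoint T y).
Proof.
have [M M0 TM] := bop_bounded T.
have /choice[g gP] (z : H) : exists w, forall x, inner (T x) z = inner x w.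
  apply: (@riesz _ (M * sqnorm z)) => [a u v||u].
  - by rewrite linearP innerDl innerZl.
  - by rewrite mulr_ge0// sqnorm_ge0.
  - apply: le_trans (inner_CS _ _) _.
    by rewrite mulrAC; apply: ler_wpM2r (TM u); exact: sqnorm_ge0.
have gl : linear g.
  move=> a u v; apply: inner_extr => w.
  by rewrite -gP innerDr innerZr !gP -innerZr -innerDr.
have gM u : sqnorm (g u) <= M * sqnorm u.
  have [->|g0] := eqVneq (g u) 0.
    by rewrite sqnorm0 mulr_ge0// sqnorm_ge0.
  have g1 : 0 < sqnorm (g u).
    by rewrite lt_neqAle eq_sym sqnorm_eq0 g0 sqnorm_ge0.
  rewrite -(ler_pM2l g1).
  have := inner_CS (T (g u)) u.
  rewrite /sqabs gP sqnormE /= expr0n addr0 -expr2 => h.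
  apply: le_trans h _; rewrite mulrCA mulrA.
  by apply: ler_wpM2r (TM _); exact: sqnorm_ge0.
have [S SE] := exists_bop M0 gl gM.
rewrite /adjoint; case: xgetP => [S' _ ->//|/(_ S)].
by case=> u v; rewrite SE.
Qed.

Lemma adjoint_unique (T : 'B(H)) (S : H -> H) :
  (forall x y, inner (T x) y = inner x (S y)) -> adjoint T =1 S.
Proof. by move=> TS y; apply: inner_extr => x; rewrite -adjointP TS. Qed.

Lemma exists_csub (Q : H -> Prop) : Q 0 ->
  (forall a x y, Q x -> Q y -> Q (a *: x + y)) ->
  (forall x, (forall e, 0 < e -> exists2 y, Q y & sqnorm (x - y) < e) -> Q x) ->
  exists M : closedSubspace H, forall x, (x \in M) <-> Q x.
Proof.
move=> Q0 QD Qc.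
pose p : {pred H} := fun x => `[< Q x >].
have pP x : x \in p = `[< Q x >] by [].
have psub : submod_closed p.
  split; first by rewrite pP; apply/asboolP.
  by move=> a x y; rewrite !pP => /asboolP Qx /asboolP Qy; apply/asboolP/QD.
pose M : submodClosed H := HB.pack p (GRing.isSubmodClosed.Build _ _ p psub).
have Mc : closed [set x : H | x \in M].
  move=> x xcl; apply/asboolP/Qc => e e0.
  have se : 0 < (Num.sqrt e)%:C by rewrite ltcR sqrtr_gt0.
  have [y [/asboolP Qy]] := xcl _ (nbhsx_ballx x _ se).
  rewrite -ball_normE /ball_ /= normE ltcR ltr_sqrt// => xy.
  by exists y.
by exists (ClosedSubspace Mc) => x; split=> [/asboolP|h]; last exact/asboolP.
Qed.

End Riesz.

(** * Orthogonal projections, compressions and block decompositions *)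

Section Projection.
Context {R : realType} {H : hilbertType R}.

Lemma csub_innerE (M : closedSubspace H) (x y : M) :
  inner x y = inner (val x) (val y).
Proof. by []. Qed.

Lemma csub_sqnormE (M : closedSubspace H) (x : M) : sqnorm x = sqnorm (val x).
Proof. by []. Qed.

(** The vector of M representing the functional <-, h> on M; the default value
    is never returned, by [riesz] in M. *)
Definition orth_proj (M : closedSubspace H) (h : H) : M :=
  xget 0 [set p : M | forall x : M, inner (val x) h = inner x p].

Lemma orth_projP (M : closedSubspace H) (x : M) (h : H) :
  inner (val x) h = inner x (orth_proj M h).
Proof.
rewrite /orth_proj; case: xgetP => [p _ ->//|].
have [|||p pP] := @riesz _ M (fun x => inner (val x) h) (sqnorm h).
- by move=> a u v; rewrite linearP innerDl innerZl.
- exact: sqnorm_ge0.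
- by move=> u; rewrite csub_sqnormE mulrC; exact: inner_CS.
by move=> /(_ p).
Qed.

Lemma orth_proj_val (M : closedSubspace H) (x : M) : orth_proj M (val x) = x.
Proof. by apply: inner_extr => y; rewrite -orth_projP. Qed.

Lemma orth_proj_linear (M : closedSubspace H) : linear (orth_proj M).
Proof.
move=> a x y; apply: inner_extr => z.
by rewrite -orth_projP innerDr innerZr !orth_projP -innerZr -innerDr.
Qed.

Lemma orth_proj_orth (M : closedSubspace H) (h : H) (x : M) :
  inner (val x) (h - val (orth_proj M h)) = 0.
Proof. by rewrite innerBr orth_projP subrr. Qed.

Lemma sqnorm_orth_proj (M : closedSubspace H) (h : H) :
  sqnorm h = sqnorm (orth_proj M h) + sqnorm (h - val (orth_proj M h)).
Proof.
have pd := orth_proj_orth h (orth_proj M h).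
rewrite csub_sqnormE -{1}[h](addrNK (val (orth_proj M h))).
move: pd; move: (val _) (h - _) => p d pd.
by rewrite [d + p]addrC sqnormD pd /= mulr0 addr0.
Qed.

Lemma sqnorm_orth_proj_le (M : closedSubspace H) (h : H) :
  sqnorm (orth_proj M h) <= sqnorm h.
Proof. by rewrite (sqnorm_orth_proj M h) lerDl sqnorm_ge0. Qed.

Lemma exists_compression (M : closedSubspace H) (S : 'B(H)) :
  exists C : 'B(M), forall x, C x = orth_proj M (S (val x)).
Proof.
have [K K0 SK] := bop_bounded S.
apply: (@exists_bop _ M (fun x => orth_proj M (S (val x))) K) => //.
  move=> a x y; rewrite -[LHS]/(orth_proj M (S (a *: val x + val y))) linearP.
  exact: orth_proj_linear.
by move=> x; apply: le_trans (sqnorm_orth_proj_le _ _) _; exact: SK.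
Qed.

Lemma exists_orthocomplement (M : closedSubspace H) :
  exists N : closedSubspace H,
    forall y, (y \in N) <-> forall x : M, inner (val x) y = 0.
Proof.
apply: exists_csub => [x|a x y hx hy z|y yM x].
- exact: inner0r.
- by rewrite innerDr innerZr hx hy mulr0 addr0.
have [->|x0] := eqVneq x 0; first by rewrite raddf0 inner0l.
have x1 : 0 < sqnorm x by rewrite lt_neqAle eq_sym sqnorm_eq0 x0 sqnorm_ge0.
suff : sqabs (inner (val x) y) <= 0.
  rewrite /sqabs; case: (inner _ _) => a b /= ab.
  have a2 := sqr_ge0 a; have b2 := sqr_ge0 b.
  have /eqP : a ^+ 2 = 0 by lra.
  have /eqP : b ^+ 2 = 0 by lra.
  by rewrite !sqrf_eq0 => /eqP -> /eqP ->.
apply/ler_addgt0Pr => e e0; rewrite add0r.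
have [z zM zy] := yM (e / sqnorm x) (divr_gt0 e0 x1).
rewrite -[inner _ y]subr0 -(zM x) -innerBr.
apply: le_trans (inner_CS _ _) _; rewrite -csub_sqnormE mulrC -ler_pdivlMr//.
exact: ltW.
Qed.

Context {n : nat} (X : 'I_n -> 'B(H)).
Implicit Types (w : seq 'I_n).

Lemma adjoint_id x : adjoint (bop_id : 'B(H)) x = x.
Proof. by apply: (@adjoint_unique _ _ _ idfun). Qed.

Lemma adjoint_comp (S T : 'B(H)) x :
  adjoint (bop_comp S T) x = adjoint T (adjoint S x).
Proof.
apply: (@adjoint_unique _ _ _ (fun x => adjoint T (adjoint S x))) => u v.
by rewrite -!adjointP.
Qed.

Lemma adjoint_opword_cons i w x :
  adjoint (opword X (i :: w)) x = adjoint (opword X w) (adjoint (X i) x).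
Proof. exact: adjoint_comp. Qed.

Lemma inner_ncpoly_eval (p : ncpoly R n) h k :
  inner (ncpoly_eval p X h) k =
  \sum_(w <- finsupp p) p w * inner h (adjoint (opword X w) k).
Proof.
rewrite (big_morph (inner^~ k) (fun x y => innerDl x y k) (inner0l k)).
apply: eq_bigr => w _.
by rewrite innerZl adjointP.
Qed.

End Projection.

Section Parts.
Context {R : realType} {H : hilbertType R} {n : nat}.
Variables (M : closedSubspace H) (T : 'I_n -> 'B(H)) (X : 'I_n -> 'B(M)).

(** Stated on adjoints, since only the adjoint of the word operators enters the
    quadratic forms of Phi; for a subspace that is invariant under the T_i^*,
    these X_i are the compressions of the T_i. *)
Definition coinvariant_part :=
  forall i x, val (adjoint (X i) x) = adjoint (T i) (val x).
Definition invariant_part := forall i x, val (X i x) = T i (val x).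

Lemma coinvariant_part_opword (hX : coinvariant_part) w x :
  val (adjoint (opword X w) x) = adjoint (opword T w) (val x).
Proof.
elim: w x => [|i w IH] x; first by rewrite !adjoint_id.
by rewrite !adjoint_opword_cons IH hX.
Qed.

Lemma invariant_part_opword (hX : invariant_part) w x :
  val (opword X w x) = opword T w (val x).
Proof.
elim: w => // i w IH.
by rewrite -[LHS]/(val (X i (opword X w x))) hX IH.
Qed.

(** Taking adjoints in the intertwining relation between X_w and T_w turns the
    inclusion of M into the projection onto M.  This identity on all of H, and
    not only on M, makes the inductions on iterates of Phi go through. *)
Lemma invariant_part_adjoint (hX : invariant_part) w h :
  adjoint (opword X w) (orth_proj M h) = orth_proj M (adjoint (opword T w) h).
Proof.
apply: inner_extr => y; rewrite -adjointP -!orth_projP -adjointP.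
by rewrite invariant_part_opword.
Qed.

Lemma coinvariant_part_poly (hX : coinvariant_part) (p : ncpoly R n) :
  (forall h, ncpoly_eval p T h = 0) -> forall h, ncpoly_eval p X h = 0.
Proof.
move=> pT h; apply: inner_extr => k; rewrite inner0r.
rewrite innerC inner_ncpoly_eval.
under eq_bigr => w _ do rewrite csub_innerE coinvariant_part_opword//.
by rewrite -inner_ncpoly_eval pT inner0l conjc0.
Qed.

Lemma invariant_part_poly (hX : invariant_part) (p : ncpoly R n) :
  (forall h, ncpoly_eval p T h = 0) -> forall h, ncpoly_eval p X h = 0.
Proof.
move=> pT h; apply: val_inj.
rewrite raddf0 -(pT (val h)) /ncpoly_eval raddf_sum.
by apply: eq_bigr => w _; rewrite -invariant_part_opword// linearZ.
Qed.

End Parts.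

Section Orthogonal.
Context {R : realType} {H : hilbertType R}.
Implicit Types M N : closedSubspace H.

Lemma orth_proj_mem M h : h \in M -> val (orth_proj M h) = h.
Proof.
move=> hM; have := orth_proj_val (Sub h hM : M).
by rewrite SubK => ->; rewrite SubK.
Qed.

Lemma orth_proj_complement M N h :
  (forall y, y \in N <-> forall x : M, inner (val x) y = 0) ->
  h - val (orth_proj M h) \in N.
Proof. by move=> NP; apply/NP => x; exact: orth_proj_orth. Qed.

Lemma orthogonal_decomposition_sym M N :
  orthogonal_decomposition M N -> orthogonal_decomposition N M.
Proof.
case=> orth dec; split=> [x y xN yM|h]; first by rewrite innerC orth// conjc0.
by have [x [y [xM yN ->]]] := dec h; exists y, x; split=> //; rewrite addrC.
Qed.

Lemma orthogonal_decompositionP M N y : orthogonal_decomposition M N ->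
  y \in N <-> forall x, x \in M -> inner x y = 0.
Proof.
case=> orth dec; split=> [yN x xM|yM]; first exact: orth.
have [a [b [aM bN yab]]] := dec y.
suff a0 : a = 0 by rewrite yab a0 add0r.
have := yM a aM; rewrite yab innerDr (orth _ _ aM bN) addr0 => aa.
by apply/eqP; rewrite -sqnorm_eq0 /sqnorm aa.
Qed.

Lemma complement_decomposition M N :
  (forall y, y \in N <-> forall x : M, inner (val x) y = 0) ->
  orthogonal_decomposition M N.
Proof.
move=> NP; split=> [x y xM /NP/(_ (Sub x xM))|h]; first by rewrite SubK.
exists (val (orth_proj M h)), (h - val (orth_proj M h)); split.
- exact: valP.
- exact: orth_proj_complement.
by rewrite addrC subrK.
Qed.

Lemma decomposition_orth_proj M N h : orthogonal_decomposition M N ->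
  h - val (orth_proj N h) \in M.
Proof.
move=> /orthogonal_decomposition_sym MN; apply/(orthogonal_decompositionP _ MN).
by move=> x xN; rewrite -[x](SubK N xN) orth_proj_orth.
Qed.

Section Blocks.
Context {n : nat} (T : 'I_n -> 'B(H)) (M N : closedSubspace H).
Hypothesis MN : orthogonal_decomposition M N.
Variables (C : 'I_n -> 'B(M)) (D : 'I_n -> 'B(N)).
Hypothesis inv : forall i x, x \in M -> adjoint (T i) x \in M.

Lemma compression_lower_triangular i :
  (forall x, C i x = orth_proj M (T i (val x))) ->
  (forall y, D i y = orth_proj N (T i (val y))) ->
  lower_triangular (T i) (C i) (D i).
Proof.
move=> CE DE; split=> [x|y]; rewrite ?CE ?DE.
  by apply: decomposition_orth_proj; exact: orthogonal_decomposition_sym.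
rewrite orth_proj_mem//; apply/(orthogonal_decompositionP _ MN) => x xM.
by rewrite innerC adjointP innerC (MN.1 _ _ (inv i xM) (valP y)) !conjc0.
Qed.

Hypothesis low : forall i, lower_triangular (T i) (C i) (D i).

Lemma lower_triangular_coinvariant : coinvariant_part T C.
Proof.
move=> i x; pose S (z : M) : M := Sub (adjoint (T i) (val z)) (inv i (valP z)).
have -> : adjoint (C i) x = S x; last by rewrite SubK.
apply: adjoint_unique => y z; rewrite !csub_innerE SubK -adjointP.
apply/eqP; rewrite eq_sym -subr_eq0 -innerBl innerC MN.1 ?conjc0//.
  exact: valP.
exact: (low i).1.
Qed.

Lemma lower_triangular_invariant : invariant_part T D.
Proof. by move=> i y; rewrite (low i).2. Qed.

End Blocks.

End Orthogonal.

(** * Monotone sequences of positive contractions *)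

Section Contractions.
Context {R : realType} {H : hilbertType R}.

Definition qform (Y : H -> H) (h : H) : R := complex.Re (inner (Y h) h).

Definition symmetric_op (Y : H -> H) :=
  forall h k, inner (Y h) k = inner h (Y k).

Definition pos_contraction (Y : H -> H) :=
  symmetric_op Y /\ forall h, 0 <= qform Y h <= sqnorm h.

Lemma sym_qformE (Y : H -> H) h :
  symmetric_op Y -> inner (Y h) h = (qform Y h)%:C.
Proof.
move=> Ys; have := Ys h h; rewrite [RHS]innerC /qform.
by case: (inner (Y h) h) => a b [] /= hb; congr (_ +i* _); lra.
Qed.

Lemma qform_parallelogram (Y : {linear H -> H}) h k :
  qform Y (h + k) + qform Y (h - k) = 2 * qform Y h + 2 * qform Y k.
Proof.
rewrite /qform (linearD Y) (linearB Y) !innerBl !innerDl !innerBr !innerDr.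
case: (inner (Y h) h) => a1 b1; case: (inner (Y h) k) => a2 b2.
case: (inner (Y k) h) => a3 b3; case: (inner (Y k) k) => a4 b4 /=; ring.
Qed.

Lemma qformZ (Y : {linear H -> H}) a h : qform Y (a *: h) = sqabs a * qform Y h.
Proof.
rewrite /qform /sqabs (linearZ_LR Y) innerZl innerZr.
case: (inner _ _) => b c; case: a => d e /=; ring.
Qed.

(** B^2 <= B whenever 0 <= B <= I, without a square root of B: positivity of B
    at h - B h and B <= I at B h give 0 <= <B h, h> - |B h|^2. *)
Lemma sqnorm_le_qform (B : H -> H) h :
  linear B -> pos_contraction B ->
  sqnorm (B h) <= qform B h.
Proof.
move=> Bl [Bs B01].
pose L : {linear H -> H} := HB.pack B (GRing.isLinear.Build _ _ _ _ B Bl).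
have /andP[h1 _] := B01 (h - B h); have /andP[_ h2] := B01 (B h).
have E : qform B (h - B h) = qform B h - 2 * sqnorm (B h) + qform B (B h).
  rewrite /qform; have -> : B (h - B h) = B h - B (B h) by exact: (linearB L).
  rewrite !innerBl !innerBr (Bs (B h) h) sqnormE.
  case: (inner (B h) h) => a1 b1; case: (inner (B (B h)) (B h)) => a2 b2 /=;
    ring.
by move: h1 h2; rewrite E; lra.
Qed.

(** By [sqnorm_le_qform] applied to the difference of two terms,
    |A_m h - A_p h|^2 is at most the increment of the monotone bounded sequence
    <A_m h, h>; so (A_m h) is Cauchy in norm. *)
Lemma monotone_cvg (A : nat -> H -> H) : (forall m, linear (A m)) ->
  (forall m, pos_contraction (A m)) ->
  (forall h, {homo (fun m => qform (A m) h) : m p / (m <= p)%N >-> m <= p}) ->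
  exists Z : 'B(H), pos_contraction Z /\ forall h, A m h @[m --> \oo] --> Z h.
Proof.
move=> Al Ac Am.
have /choice[g gP] (h : H) : exists z : H, A m h @[m --> \oo] --> z.
  have qc : cvgn (fun m => qform (A m) h).
    apply: nondecreasing_is_cvgn; first exact: Am.
    by exists (sqnorm h) => _ [m _ <-]; have [_ /(_ h)/andP[]] := Ac m.
  have [l ql] : exists l : R, qform (A m) h @[m --> \oo] --> l.
    by exists (limn (fun m => qform (A m) h)).
  have lq m : qform (A m) h <= l.
    rewrite -(cvg_lim _ ql)//; apply: nondecreasing_cvgn_le => //; exact: Am.
  apply: (@sqnorm_cauchy _ _ _ (fun m => l - qform (A m) h)).
    by rewrite -(subrr l); exact: (cvgB (cvg_cst l) ql).
  move=> m p mp; pose B := fun x => A p x - A m x.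
  have Bq x : qform B x = qform (A p) x - qform (A m) x.
    by rewrite /qform /B innerBl ReB.
  have Bl : linear B.
    by move=> a x y; rewrite /B !Al scalerBr opprD addrACA.
  have Bc : pos_contraction B.
    split=> [x y|x].
      by rewrite /B innerBl innerBr (Ac p).1 (Ac m).1.
    rewrite Bq subr_ge0 Am//= lerBlDr.
    have /andP[_ h1] := (Ac p).2 x; have /andP[h2 _] := (Ac m).2 x.
    by rewrite (le_trans h1)// lerDl.
  have -> : sqnorm (A m h - A p h) = sqnorm (B h).
    by rewrite -opprB /sqnorm linearNl linearNr opprK.
  by apply: le_trans (sqnorm_le_qform _ Bl Bc) _; rewrite Bq lerD2r.
have gs : symmetric_op g.
  move=> h k; rewrite [RHS]innerC.
  have h1 := inner_cvgl (y := k) (gP h).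
  have h2 := conj_cvg (inner_cvgl (y := h) (gP k)).
  apply: (norm_cvg_unique h1); apply: seq_cvg_ext h2 => m.
  by rewrite -innerC (Ac m).1.
have gl : linear g.
  move=> a x y; apply: (norm_cvg_unique (gP _)).
  apply: (@seq_cvg_ext _ (fun m => a *: A m x + A m y)) => [m|].
    by rewrite Al.
  by apply: cvgD (gP y); exact: (cvgZ (cvg_cst a) (gP x)).
(* Let m tend to infinity in |g h|^2 <= 2 |g h - A_m h|^2 + 2 |A_m h|^2. *)
have gM h : sqnorm (g h) <= 2 * sqnorm h.
  have c : 2 * sqnorm (g h - A m h) + 2 * sqnorm h @[m --> \oo] -->
      2 * 0 + 2 * sqnorm h.
    apply: cvgD (cvg_cst _); apply: cvgM (cvg_cst _) _.
    by apply/hilbert_cvgP; exact: gP.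
  move: c; rewrite mulr0 add0r => /cvgr_to_ge; apply.
  apply: nearW => m; rewrite -{1}[g h](subrK (A m h)).
  apply: le_trans (sqnormD_le _ _) _; rewrite lerD2l ler_pM2l//.
  apply: le_trans (sqnorm_le_qform h (Al m) (Ac m)) _.
  by have /andP[] := (Ac m).2 h.
have [Z ZE] := exists_bop (ler0n _ 2) gl gM.
exists Z; split; last by move=> h; rewrite ZE.
split=> [h k|h].
  by rewrite !ZE.
have c1 := Re_cvg (inner_cvgl (y := h) (gP h)).
rewrite /qform ZE; apply/andP; split.
  apply: (cvgr_to_ge c1); apply: nearW => m.
  by have /andP[] := (Ac m).2 h.
apply: (cvgr_to_le c1); apply: nearW => m.
by have /andP[] := (Ac m).2 h.
Qed.

End Contractions.

(** * The map Phi and the quadratic forms of its iterates *)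

Section Phi.
Context {R : realType} {n : nat} {H : hilbertType R}.
Variables (f : posRegular R n) (X : 'I_n -> 'B(H)).
Implicit Types (Y Z : 'B(H)) (phi psi : H -> R).

(** The effect of the partial sums of Phi on quadratic forms. *)
Definition word_sum phi (m : nat) (h : H) : R :=
  \sum_(1 <= k < m.+1) \sum_(w : k.-tuple 'I_n)
    f w * phi (adjoint (opword X w) h).

Lemma word_sumS phi m h : word_sum phi m.+1 h = word_sum phi m h +
  \sum_(w : m.+1.-tuple 'I_n) f w * phi (adjoint (opword X w) h).
Proof. by rewrite /word_sum big_nat_recr. Qed.

Lemma le_word_sum phi psi m h : (forall x, phi x <= psi x) ->
  word_sum phi m h <= word_sum psi m h.
Proof.
move=> le; apply: ler_sum => k _; apply: ler_sum => w _.
by apply: ler_wpM2l (le _); exact: coef_ge0.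
Qed.

Lemma word_sum_ge0 phi m h : (forall x, 0 <= phi x) -> 0 <= word_sum phi m h.
Proof.
move=> phi0; apply: sumr_ge0 => k _; apply: sumr_ge0 => w _.
by apply: mulr_ge0 => //; exact: coef_ge0.
Qed.

Lemma word_sum_homo phi h : (forall x, 0 <= phi x) ->
  {homo (fun m => word_sum phi m h) : m p / (m <= p)%N >-> m <= p}.
Proof.
move=> phi0; apply: homo_leq => [//|x y z|m]; first exact: le_trans.
rewrite word_sumS lerDl; apply: sumr_ge0 => w _.
by apply: mulr_ge0 => //; exact: coef_ge0.
Qed.

Lemma word_sum_sub_le phi psi m p h :
  (forall x, phi x <= psi x) -> (m <= p)%N ->
  word_sum phi p h - word_sum phi m h <= word_sum psi p h - word_sum psi m h.
Proof.
move=> le /subnK <-; elim: (p - m)%N => [|d IH]; first by rewrite add0n !subrr.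
rewrite addSn !word_sumS.
set a := (X in _ + X - _ <= _); set b := (X in _ <= _ + X - _).
suff ab : a <= b by lra.
by apply: ler_sum => w _; apply: ler_wpM2l (le _); exact: coef_ge0.
Qed.

Lemma inner_Phi_partial Y m h k : inner (Phi_partial f X Y m h) k =
  \sum_(1 <= j < m.+1) \sum_(w : j.-tuple 'I_n)
    (f w)%:C * inner (Y (adjoint (opword X w) h)) (adjoint (opword X w) k).
Proof.
have S := big_morph (inner^~ k) (fun x y => innerDl x y k) (inner0l k).
rewrite /Phi_partial S; apply: eq_bigr => j _; rewrite S; apply: eq_bigr => w _.
by rewrite innerZl adjointP.
Qed.

Lemma qform_Phi_partial Y m h :
  qform (Phi_partial f X Y m) h = word_sum (qform Y) m h.
Proof.
have ReD : {morph (@complex.Re R) : x y / x + y} by case=> ? ? [].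
have Re0 : complex.Re (0 : R[i]) = 0 by [].
rewrite /qform inner_Phi_partial (big_morph _ ReD Re0).
apply: eq_bigr => j _; rewrite (big_morph _ ReD Re0).
by apply: eq_bigr => w _; case: (inner _ _) => a b /=; rewrite mul0r subr0.
Qed.

Lemma sym_Phi_partial Y m :
  symmetric_op Y -> symmetric_op (Phi_partial f X Y m).
Proof.
move=> Ys h k; rewrite [RHS]innerC !inner_Phi_partial rmorph_sum.
apply: eq_bigr => j _; rewrite rmorph_sum; apply: eq_bigr => w _.
by rewrite rmorphM Ys innerC; congr (_ * _); exact/esym/conjc_real.
Qed.

Lemma linear_Phi_partial Y m : linear (Phi_partial f X Y m).
Proof.
move=> a x y; rewrite /Phi_partial scaler_sumr -big_split.
apply: eq_bigr => k _.
rewrite scaler_sumr -big_split; apply: eq_bigr => w _.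
by rewrite !linearP.
Qed.

(** A form of the inequality defining the variety that mentions neither a limit
    nor an operator; see [row_contractionP]. *)
Definition row_contraction := forall m h, word_sum sqnorm m h <= sqnorm h.

Lemma pos_contraction_id : pos_contraction (bop_id : 'B(H)).
Proof. by split=> // h; rewrite sqnorm_ge0 lexx. Qed.

Lemma wot_unique (S : nat -> H -> H) (Z Z' : H -> H) :
  wot_cvg S Z -> wot_cvg S Z' -> Z =1 Z'.
Proof.
move=> SZ SZ' h; apply/eqP; rewrite -subr_eq0 -sqnorm_eq0 /sqnorm innerBl.
by rewrite (norm_cvg_unique (SZ h (Z h - Z' h)) (SZ' h (Z h - Z' h))) subrr.
Qed.

Lemma qform_ext (Z Z' : H -> H) : Z =1 Z' -> qform Z =1 qform Z'.
Proof. by move=> ZZ h; rewrite /qform ZZ. Qed.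

Lemma pos_contraction_ext (Z Z' : H -> H) :
  Z =1 Z' -> pos_contraction Z -> pos_contraction Z'.
Proof.
move=> ZZ [Zs Z01]; split=> [h k|h]; first by rewrite -!ZZ.
by rewrite -(qform_ext ZZ).
Qed.

(** For 0 <= Y <= I the partial sums of the series of Phi(Y) increase and are
    bounded by those for I, hence by I. *)
Lemma Phi_pos_contraction Y : row_contraction -> pos_contraction Y ->
  [/\ pos_contraction (Phi f X Y), wot_cvg (Phi_partial f X Y) (Phi f X Y) &
      forall h, word_sum (qform Y) m h @[m --> \oo] --> qform (Phi f X Y) h].
Proof.
move=> rc [Ys Y01].
have Y0 x : 0 <= qform Y x by have /andP[] := Y01 x.
have Y1 x : qform Y x <= sqnorm x by have /andP[] := Y01 x.
have [m|m|h m p mp|Z [Zc AZ]] := @monotone_cvg _ H (Phi_partial f X Y).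
- exact: linear_Phi_partial.
- split; first exact: sym_Phi_partial.
  move=> h; rewrite qform_Phi_partial word_sum_ge0//=.
  by apply: le_trans (rc m h); exact: le_word_sum.
- by rewrite !qform_Phi_partial; exact: word_sum_homo.
have SZ : wot_cvg (Phi_partial f X Y) Z by move=> h k; exact: inner_cvgl.
have SP : wot_cvg (Phi_partial f X Y) (Phi f X Y).
  exact: (@xgetPex _ bop_id [set V : 'B(H) | wot_cvg _ V] (ex_intro _ Z SZ)).
have PZ := wot_unique SZ SP.
split=> // [|h]; first exact: pos_contraction_ext Zc.
apply: (@seq_cvg_ext _ (fun m => qform (Phi_partial f X Y m) h)) => [m|].
  exact: qform_Phi_partial.
by apply: Re_cvg; exact: SP.
Qed.

Lemma row_contractionP : row_contraction <->
  exists2 Z : 'B(H), wot_cvg (Phi_partial f X bop_id) Z & ople Z bop_id.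
Proof.
split=> [rc|[Z SZ Z1] m h].
  have [[Zs Z01] SZ _] := Phi_pos_contraction rc pos_contraction_id.
  exists (Phi f X bop_id) => // h; rewrite (sym_qformE h Zs) sqnormE lecR.
  by have /andP[] := Z01 h.
have c : word_sum sqnorm m h @[m --> \oo] --> qform Z h.
  apply: (@seq_cvg_ext _ (fun m => qform (Phi_partial f X bop_id m) h)) => [p|].
    exact: qform_Phi_partial.
  by apply: Re_cvg; exact: SZ.
have Zh : qform Z h <= sqnorm h by have := Z1 h; rewrite lecE => /andP[].
apply: le_trans Zh; apply: (cvgr_to_ge c); exists m => // p /= mp.
by apply: word_sum_homo => // x; exact: sqnorm_ge0.
Qed.

Definition qpow (k : nat) : H -> R := qform (iter k (Phi f X) bop_id).

Hypothesis rc : row_contraction.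

Lemma iter_pos_contraction k : pos_contraction (iter k (Phi f X) bop_id).
Proof.
elim: k => [|k IH]; first exact: pos_contraction_id.
by have [] := Phi_pos_contraction rc IH.
Qed.

Lemma qpowS_cvg k h : word_sum (qpow k) m h @[m --> \oo] --> qpow k.+1 h.
Proof. by have [_ _] := Phi_pos_contraction rc (iter_pos_contraction k). Qed.

Lemma qpow_ge0 k h : 0 <= qpow k h.
Proof. by have [_ /(_ h)/andP[]] := iter_pos_contraction k. Qed.

Lemma qpow_le k h : qpow k h <= sqnorm h.
Proof. by have [_ /(_ h)/andP[]] := iter_pos_contraction k. Qed.

Lemma Phi_seqE h k : Phi_seq f X h k = (qpow k h)%:C.
Proof. by apply: sym_qformE; have [] := iter_pos_contraction k. Qed.

Lemma qpow_parallelogram k h h' :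
  qpow k (h + h') + qpow k (h - h') = 2 * qpow k h + 2 * qpow k h'.
Proof. exact: qform_parallelogram. Qed.

Lemma qpowD_le k h h' : qpow k (h + h') <= 2 * qpow k h + 2 * qpow k h'.
Proof. by rewrite -qpow_parallelogram lerDl qpow_ge0. Qed.

Lemma qpowZ k a h : qpow k (a *: h) = sqabs a * qpow k h.
Proof. exact: qformZ. Qed.

Lemma word_sum_le_qpow k m h : word_sum (qpow k) m h <= qpow k.+1 h.
Proof.
apply: (cvgr_to_ge (@qpowS_cvg k h)); exists m => // p /= mp.
by apply: word_sum_homo => // x; exact: qpow_ge0.
Qed.

Lemma qpowS_le k h : qpow k.+1 h <= qpow k h.
Proof.
elim: k h => [|k IH] h; first exact: qpow_le.
apply: (ler_cvg_to (@qpowS_cvg k.+1 h) (@qpowS_cvg k h)).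
by apply: nearW => m; exact: le_word_sum.
Qed.

(** The limit exists because Q_(k+1) <= Q_k, by induction from Q_1 <= I. *)
Lemma qpow_cvg h : exists l : R, qpow k h @[k --> \oo] --> l.
Proof.
apply/cvg_ex; apply: nonincreasing_is_cvgn.
  by apply/nonincreasing_seqP => k; exact: qpowS_le.
by exists 0 => _ [k _ <-]; exact: qpow_ge0.
Qed.

Lemma class_C0P : class_C0 f X <-> forall h, qpow k h @[k --> \oo] --> (0 : R).
Proof.
have E h : (Phi_seq f X h : nat -> R[i]^o) = (fun k => (qpow k h)%:C).
  by apply/funext => k; exact: Phi_seqE.
by split=> C0 h; have := C0 h; rewrite E real_cvg.
Qed.

(** Since the limit always exists, being of class C.1 only says that it is 0
    at no nonzero vector. *)
Lemma class_C1P : class_C1 f X <->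
  forall h, qpow k h @[k --> \oo] --> (0 : R) -> h = 0.
Proof.
have E h : (Phi_seq f X h : nat -> R[i]^o) = (fun k => (qpow k h)%:C).
  by apply/funext => k; exact: Phi_seqE.
split=> [C1 h /real_cvg h0|C1 h h0].
  apply/eqP; apply: contraT => /C1[l]; rewrite E => hl.
  by rewrite (norm_cvg_unique hl h0) eqxx.
have [l hl] := qpow_cvg h; exists (l%:C : R[i]^o).
  by rewrite E -real_cvg.
apply: contra_neq h0 => l0; apply: C1; move: hl.
by case: l0 => ->.
Qed.

End Phi.

(** * Vectors on which the iterates vanish *)

Section Null.
Context {R : realType} {n : nat} {H : hilbertType R} (f : posRegular R n).
Variables (T : 'I_n -> 'B(H)).
Hypothesis rc : row_contraction f T.

Definition null_vector h := qpow f T k h @[k --> \oo] --> (0 : R).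

Lemma null_vector_linear a x y :
  null_vector x -> null_vector y -> null_vector (a *: x + y).
Proof.
move=> x0 y0.
apply: (@cvg0_le _ _
  (fun k => 2 * (sqabs a * qpow f T k x) + 2 * qpow f T k y)).
  by move=> k; rewrite qpow_ge0//= -qpowZ// qpowD_le.
have c : 2 * (sqabs a * qpow f T k x) + 2 * qpow f T k y @[k --> \oo] -->
    2 * (sqabs a * 0) + 2 * 0.
  apply: cvgD; apply: cvgM (cvg_cst _) _; last exact: y0.
  by apply: cvgM (cvg_cst _) _; exact: x0.
by move: c; rewrite !mulr0 addr0.
Qed.

Lemma null_vector_closed x :
  (forall e, 0 < e -> exists2 y, null_vector y & sqnorm (x - y) < e) ->
  null_vector x.
Proof.
move=> xQ; apply/cvgrPdist_lt => e e0.
have e4 : 0 < e / 4 by rewrite divr_gt0.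
have [y /cvgrPdist_lt/(_ _ e4) y0 xy] := xQ _ e4.
apply: filterS y0 => k; rewrite !sub0r !normrN !ger0_norm ?qpow_ge0// => yk.
rewrite -(subrK y x); apply: le_lt_trans (qpowD_le rc _ _ _) _.
have := qpow_le rc k (x - y); lra.
Qed.

(** The term of the word g_i alone is at most the whole series, and its
    coefficient is nonzero. *)
Lemma null_vector_adjoint i x : null_vector x -> null_vector (adjoint (T i) x).
Proof.
move=> x0; have fi := coef_gen f i.
apply: (@cvg0_le _ _ (fun k => (f [:: i])^-1 * qpow f T k.+1 x)) => [k|].
  rewrite qpow_ge0//= -ler_pdivrMl ?invr_gt0// invrK.
  apply: le_trans (word_sum_le_qpow rc k 1 x).
  rewrite /word_sum big_nat1 (bigD1 [tuple i])//= adjoint_comp adjoint_id lerDl.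
  by apply: sumr_ge0 => w _; apply: mulr_ge0; [exact: coef_ge0|exact: qpow_ge0].
rewrite -(mulr0 (f [:: i])^-1); apply: cvgM (cvg_cst _) _.
by rewrite (cvg_shiftS (fun j => qpow f T j x)).
Qed.

(** The cross term c is the real part of <u, Q_k v>, and |Q_k v|^2 is at most
    <Q_k v, v> by [sqnorm_le_qform]. *)
Lemma qpowD k u v : exists2 c,
  qpow f T k (u + v) = qpow f T k u + qpow f T k v + 2 * c &
  c ^+ 2 <= sqnorm u * qpow f T k v.
Proof.
set A : 'B(H) := iter k (Phi f T) bop_id.
have Ac : pos_contraction A := iter_pos_contraction rc k.
exists (complex.Re (inner u (A v))).
  rewrite /qpow -/A /qform (linearD A) !innerDl !innerDr.
  rewrite (Ac.1 u v) (innerC (A v) u).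
  case: (inner u (A v)) => a b; case: (inner (A u) u) => a1 b1.
  case: (inner (A v) v) => a2 b2 /=; ring.
apply: (@le_trans _ _ (sqnorm u * sqnorm (A v))).
  by apply: le_trans (inner_CS u (A v)); rewrite lerDl sqr_ge0.
by apply: ler_wpM2l (sqnorm_le_qform v (linearP A) Ac); exact: sqnorm_ge0.
Qed.

(** The cross terms of [qpowD] tend to 0. *)
Lemma qlimD_null (q : H -> R) u v :
  (forall h, qpow f T k h @[k --> \oo] --> q h) ->
  null_vector v -> q (u + v) = q u.
Proof.
move=> qP v0.
have /choice[c cP] k : exists c,
    qpow f T k (u + v) = qpow f T k u + qpow f T k v + 2 * c /\
    c ^+ 2 <= sqnorm u * qpow f T k v.
  by have [c] := qpowD k u v; exists c.
have c0 : c @ \oo --> (0 : R).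
  apply: sqr_cvg0.
  apply: (@cvg0_le _ _ (fun k => sqnorm u * qpow f T k v)) => [k|].
    by rewrite sqr_ge0 (cP k).2.
  by rewrite -(mulr0 (sqnorm u)); apply: cvgM (cvg_cst _) _.
apply: (norm_cvg_unique (qP (u + v))).
apply: (@seq_cvg_ext _
  (fun k => qpow f T k u + qpow f T k v + 2 * c k)) => [k|].
  by rewrite (cP k).1.
have -> : q u = q u + 0 + 2 * 0 by rewrite mulr0 !addr0.
by apply: cvgD; [exact: cvgD|exact: cvgM (cvg_cst _) _].
Qed.

End Null.

(** * Parts of a tuple on coinvariant and invariant subspaces *)

Section CoinvariantPart.
Context {R : realType} {n : nat} {H : hilbertType R} (f : posRegular R n).
Variables (M : closedSubspace H) (T : 'I_n -> 'B(H)) (X : 'I_n -> 'B(M)).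
Hypotheses (hX : coinvariant_part T X) (rc : row_contraction f T).

Lemma coinvariant_word_sum (phi : M -> R) (psi : H -> R) m x :
  (forall y, phi y = psi (val y)) ->
  word_sum f X phi m x = word_sum f T psi m (val x).
Proof.
move=> E; apply: eq_bigr => k _; apply: eq_bigr => w _.
by rewrite E (coinvariant_part_opword hX).
Qed.

Lemma coinvariant_row_contraction : row_contraction f X.
Proof. by move=> m x; rewrite (@coinvariant_word_sum _ sqnorm). Qed.

Lemma coinvariant_qpow k x : qpow f X k x = qpow f T k (val x).
Proof.
elim: k x => [//|k IH] x.
apply: (norm_cvg_unique (@qpowS_cvg _ _ _ _ _ coinvariant_row_contraction k x)).
apply: seq_cvg_ext (@qpowS_cvg _ _ _ _ _ rc k (val x)) => m.
by rewrite (coinvariant_word_sum _ _ IH).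
Qed.

End CoinvariantPart.

Section InvariantPart.
Context {R : realType} {n : nat} {H : hilbertType R} (f : posRegular R n).
Variables (M : closedSubspace H) (T : 'I_n -> 'B(H)) (X : 'I_n -> 'B(M)).
Hypotheses (hX : invariant_part T X) (rc : row_contraction f T).

Lemma invariant_word_sum (phi : M -> R) m h :
  word_sum f X phi m (orth_proj M h) =
  word_sum f T (fun z => phi (orth_proj M z)) m h.
Proof.
apply: eq_bigr => k _; apply: eq_bigr => w _.
by rewrite (invariant_part_adjoint hX).
Qed.

Lemma invariant_row_contraction : row_contraction f X.
Proof.
move=> m x; rewrite -[x]orth_proj_val invariant_word_sum.
rewrite [leRHS]csub_sqnormE orth_proj_val; apply: le_trans (rc m (val x)).
by apply: le_word_sum => z; exact: sqnorm_orth_proj_le.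
Qed.

Let rcX := invariant_row_contraction.

Lemma invariant_qpow_le k h : qpow f X k (orth_proj M h) <= qpow f T k h.
Proof.
elim: k h => [|k IH] h; first exact: sqnorm_orth_proj_le.
apply: (ler_cvg_to (@qpowS_cvg _ _ _ _ _ rcX k (orth_proj M h))
                   (@qpowS_cvg _ _ _ _ _ rc k h)).
by apply: nearW => m; rewrite invariant_word_sum; exact: le_word_sum.
Qed.

(** The tail after m of the series of Phi(Q_k) is at most the tail of the series
    of Phi(I), whatever k is: this uniformity allows k to tend to infinity
    before m does. *)
Lemma qpowS_le_word_sum k m h :
  qpow f T k.+1 h <= word_sum f T (qpow f T k) m h +
    (qpow f T 1 h - word_sum f T sqnorm m h).
Proof.
have c : word_sum f T (qpow f T k) m h +
      (word_sum f T sqnorm p h - word_sum f T sqnorm m h) @[p --> \oo] -->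
    word_sum f T (qpow f T k) m h +
      (qpow f T 1 h - word_sum f T sqnorm m h).
  apply: cvgD (cvg_cst _) _; apply: cvgB _ (cvg_cst _).
  exact: (@qpowS_cvg _ _ _ _ _ rc 0 h).
apply: (ler_cvg_to (@qpowS_cvg _ _ _ _ _ rc k h) c).
exists m => // p /= mp; rewrite -lerBlDl.
by apply: word_sum_sub_le => // x; exact: qpow_le.
Qed.

(** The limit form q satisfies q(h) <= the sum of the a_w q(T_w^* h), so a bound
    of q by the k-th form of X, read through the projection, passes to the
    (k+1)-st. *)
Lemma qpow_lim_le (q : H -> R) :
  (forall h, qpow f T k h @[k --> \oo] --> q h) ->
  (forall h, q h <= sqnorm (orth_proj M h)) ->
  forall k h, q h <= qpow f X k (orth_proj M h).
Proof.
move=> qP q0; elim=> [//|k IH] h.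
have tail m : q h <=
    word_sum f T q m h + (qpow f T 1 h - word_sum f T sqnorm m h).
  have c : word_sum f T (qpow f T j) m h +
        (qpow f T 1 h - word_sum f T sqnorm m h) @[j --> \oo]
      --> word_sum f T q m h + (qpow f T 1 h - word_sum f T sqnorm m h).
    apply: cvgD _ (cvg_cst _).
    apply: (cvg_big add_continuous) => i _.
    apply: (cvg_big add_continuous) => w _.
    by apply: cvgM (cvg_cst _) (qP _).
  have qS : qpow f T j.+1 h @[j --> \oo] --> q h.
    by have := qP h; rewrite -(cvg_shiftS (fun j => qpow f T j h)).
  by apply: (ler_cvg_to qS c); apply: nearW => j; exact: qpowS_le_word_sum.
have c : qpow f X k.+1 (orth_proj M h) +
      (qpow f T 1 h - word_sum f T sqnorm m h) @[m --> \oo]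
    --> qpow f X k.+1 (orth_proj M h) + (qpow f T 1 h - qpow f T 1 h).
  apply: cvgD (cvg_cst _) _; apply: cvgB (cvg_cst _) _.
  exact: (@qpowS_cvg _ _ _ _ _ rc 0 h).
move: c; rewrite subrr addr0 => /cvgr_to_ge; apply; apply: nearW => m.
apply: le_trans (tail m) _; rewrite lerD2r.
apply: le_trans (word_sum_le_qpow rcX k m (orth_proj M h)).
by rewrite invariant_word_sum; exact: le_word_sum.
Qed.

End InvariantPart.

(** * Existence and uniqueness of the triangulation *)

Section Classes.
Context {R : realType} {n : nat} {H : hilbertType R} (f : posRegular R n).
Variables (M N : closedSubspace H) (T : 'I_n -> 'B(H)).
Variables (C : 'I_n -> 'B(M)) (D : 'I_n -> 'B(N)).
Hypothesis rc : row_contraction f T.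

Lemma coinvariant_class_C0 : coinvariant_part T C ->
  class_C0 f C <-> (forall x, x \in M -> null_vector f T x).
Proof.
move=> hC; rewrite (class_C0P (coinvariant_row_contraction hC rc)).
split=> [C0 x xM|MT x].
  apply: seq_cvg_ext (C0 (Sub x xM)) => k.
  by rewrite (coinvariant_qpow hC rc) SubK.
by apply: seq_cvg_ext (MT _ (valP x)) => k; rewrite (coinvariant_qpow hC rc).
Qed.

(** On N the limit form of T bounds the forms of D from below, and it vanishes
    only at vectors of M, which are orthogonal to N. *)
Lemma invariant_class_C1 : orthogonal_decomposition M N -> invariant_part T D ->
  (forall x, x \in M <-> null_vector f T x) -> class_C1 f D.
Proof.
move=> MN hD MT; apply/(class_C1P (invariant_row_contraction hD rc)) => y y0.
have /choice[q qP] := qpow_cvg rc.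
(* h - E h lies in M, the null space of q, so q(h) = q(E h) <= |E h|^2. *)
have q_orth_proj h : q h <= sqnorm (orth_proj N h).
  have hM : null_vector f T (h - val (orth_proj N h)).
    by apply/MT/decomposition_orth_proj.
  rewrite -[h in q h](subrK (val (orth_proj N h))) addrC.
  rewrite (qlimD_null rc _ qP hM).
  apply: (cvgr_to_le (qP (val (orth_proj N h)))); apply: nearW => k.
  exact: (qpow_le rc).
have qy k : q (val y) <= qpow f D k y.
  rewrite -[y in leRHS]orth_proj_val.
  exact: (qpow_lim_le hD rc qP q_orth_proj).
have q0 : q (val y) = 0.
  apply/eqP; rewrite eq_le; apply/andP; split.
    by apply: (cvgr_to_ge y0); apply: nearW => k.
  by apply: (cvgr_to_ge (qP (val y))); apply: nearW => k; exact: (qpow_ge0 rc).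
have yM : val y \in M by apply/MT; rewrite /null_vector -q0; exact: qP.
by apply/eqP; rewrite -sqnorm_eq0 csub_sqnormE /sqnorm (MN.1 _ _ yM (valP y)).
Qed.

(** If x = u + v with u in M and v in N, then v is a null vector along with x
    and u; the forms of D are bounded above by those of T, so v = 0. *)
Lemma invariant_class_C1_null :
  orthogonal_decomposition M N -> invariant_part T D ->
  class_C1 f D -> (forall x, x \in M -> null_vector f T x) ->
  forall x, null_vector f T x -> x \in M.
Proof.
move=> MN hD C1 MT x x0.
have [u [v [uM vN xuv]]] := MN.2 x.
have v0 : null_vector f T v.
  have -> : v = (-1) *: u + x by rewrite xuv scaleN1r addKr.
  by apply: (null_vector_linear rc) x0; exact: MT.
suff vz : Sub v vN = 0 :> N by rewrite xuv -[v](SubK N vN) vz raddf0 addr0.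
apply: (class_C1P (invariant_row_contraction hD rc)).1 C1 _ _.
apply: (@cvg0_le _ _ (qpow f T ^~ v)) v0 => k.
rewrite (qpow_ge0 (invariant_row_contraction hD rc))/=.
by rewrite -[Sub v vN]orth_proj_val SubK; exact: (invariant_qpow_le hD rc).
Qed.

End Classes.

Section Triangulations.
Context {R : realType} {n : nat} {H : hilbertType R} (f : posRegular R n).
Context (P : set (ncpoly R n)) (T : 'I_n -> 'B(H)).
Hypothesis hT : variety f P T.

Let rc : row_contraction f T := (row_contractionP f T).2 hT.1.

(** This determines the first summand of a triangulation from T and f alone,
    whence uniqueness. *)
Lemma triangulation_null H0 H1 x : triangulation_C0_C1 f P T H0 H1 ->
  x \in H0 <-> null_vector f T x.
Proof.
case=> MN [C [D [low inv [_ C0] [_ C1]]]].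
have hC := lower_triangular_coinvariant MN inv low.
have hD := lower_triangular_invariant low.
have C0' := (coinvariant_class_C0 rc hC).1 C0.
by split=> [|x0]; [exact: C0'|exact: (invariant_class_C1_null rc MN hD C1 C0')].
Qed.

Lemma triangulation_exists : exists H0 H1, triangulation_C0_C1 f P T H0 H1.
Proof.
have [H0 H0P] : exists M : closedSubspace H,
    forall x, x \in M <-> null_vector f T x.
  apply: exists_csub => [|a x y|x]; first 2 last.
  - exact: (null_vector_closed rc).
  - apply: (@cvg0_le _ _ (fun=> 0)); last exact: cvg_cst.
    by move=> k; rewrite (qpow_ge0 rc) (le_trans (qpow_le rc _ _))// sqnorm0.
  - exact: (null_vector_linear rc).
have [H1 H1P] := exists_orthocomplement H0.
have MN := complement_decomposition H1P.
have inv i x : x \in H0 -> adjoint (T i) x \in H0.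
  by move=> /H0P x0; apply/H0P/(null_vector_adjoint rc).
have /choice[C CE] i := exists_compression H0 (T i).
have /choice[D DE] i := exists_compression H1 (T i).
have low i : lower_triangular (T i) (C i) (D i).
  by apply: (compression_lower_triangular MN inv).
have hC := lower_triangular_coinvariant MN inv low.
have hD := lower_triangular_invariant low.
exists H0, H1; split=> //; exists C, D; split=> //; split.
- split; first exact/row_contractionP/(coinvariant_row_contraction hC rc).
  by move=> p Pp; apply: (coinvariant_part_poly hC); exact: hT.2.
- by apply/(coinvariant_class_C0 rc hC) => x /H0P.
- split; first exact/row_contractionP/(invariant_row_contraction hD rc).
  by move=> p Pp; apply: (invariant_part_poly hD); exact: hT.2.
- exact: (invariant_class_C1 rc MN hD H0P).
Qed.

End Triangulations.

Theorem theorem4p7 (R : realType) (n : nat) (hn : (0 < n)%N)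
    (H : hilbertType R) (f : posRegular R n) (P : set (ncpoly R n))
    (T : 'I_n -> 'B(H)) (hT : variety f P T) :
  exists H0 H1 : closedSubspace H,
    triangulation_C0_C1 f P T H0 H1 /\
    (forall H0' H1' : closedSubspace H, triangulation_C0_C1 f P T H0' H1' ->
       H0' =i H0 /\ H1' =i H1).
Proof.
have [H0 [H1 tri]] := triangulation_exists hT.
exists H0, H1; split=> // H0' H1' tri'.
have E0 x : x \in H0' <-> x \in H0.
  by rewrite (triangulation_null hT x tri) (triangulation_null hT x tri').
split=> x; apply/idP/idP; try by move=> /E0.
  move/(orthogonal_decompositionP x tri'.1) => xH.
  by apply/(orthogonal_decompositionP x tri.1) => z /E0; exact: xH.
move/(orthogonal_decompositionP x tri.1) => xH.
by apply/(orthogonal_decompositionP x tri'.1) => z /E0; exact: xH.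
Qed.
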